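(* Let $n,d$ be positive integers. For any linear order $>_L$ on $[n]\times[d]_0$, there exists a bijection $\Phi:\mathfrak{S}_n^d\to\mathfrak{S}_n^d$ such that $\mathrm{ldes}(p)=\mathrm{lexc}(\Phi(p))$ for all $p\in\mathfrak{S}_n^d$, where $\mathrm{ldes}$ and $\mathrm{lexc}$ are taken with respect to $>_L$.
   Context: Notation: $[n]=\{1,\dots,n\}$ and $[d]_0=\{0,1,\dots,d-1\}$. $\mathfrak{S}_n$ is the set of permutations of $[n]$, written as words $\pi=\pi_1\pi_2\cdots\pi_n$. The set of colored permutations $\mathfrak{S}_n^d$ consists of all pairs $p=(\pi,c)$ with $\pi\in\mathfrak{S}_n$ and $c=(c_1,\dots,c_n)\in([d]_0)^n$; $p$ is identified with the word of pairs $(\pi_1,c_1)\cdots(\pi_n,c_n)$. Given a linear (total, strict) order $>_L$ on $[n]\times[d]_0$ and $p=(\pi,c)\in\mathfrak{S}_n^d$: - $\mathrm{ldes}(p)=|\{i\in[n-1]:(\pi_i,c_i)>_L(\pi_{i+1},c_{i+1})\}|$; - $\mathrm{lexc}(p)=|\{i\in[n]:(\pi_{\pi_i},c_{\pi_i})>_L(\pi_i,c_i)\}|$. *)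

(* Defs.v *)
From mathcomp Require Import all_boot all_fingroup.

Set Implicit Arguments.
Unset Strict Implicit.
Unset Printing Implicit Defensive.

(* The sets [n] = {1,...,n} and [d]_0 = {0,...,d-1} are represented by 'I_n
   and 'I_d: the letter v of [n] is the ordinal of value v - 1. *)
Definition cperm (n d : nat) : finType := ('S_n * {ffun 'I_n -> 'I_d})%type.

Definition letter (n d : nat) (p : cperm n d) (i : 'I_n) : 'I_n * 'I_d :=
  (p.1 i, p.2 i).

(* [gtL x y] reads x >_L y. *)
Definition strict_linear_order (T : eqType) (gtL : rel T) : Prop :=
  [/\ irreflexive gtL,
      transitive gtL
    & forall x y : T, x != y -> gtL x y || gtL y x].

(* A position i has a witness j exactly when it is not the last one, and then
   j is the next position; so i ranges over [n-1]. *)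
Definition ldes (n d : nat) (gtL : rel ('I_n * 'I_d)) (p : cperm n d) : nat :=
  #|[set i : 'I_n | [exists j : 'I_n,
       (j == i.+1 :> nat) && gtL (letter p i) (letter p j)]]|.

Definition lexc (n d : nat) (gtL : rel ('I_n * 'I_d)) (p : cperm n d) : nat :=
  #|[set i : 'I_n | gtL (letter p (p.1 i)) (letter p i)]|.

(* Main.v *)
Require Import Defs.
From mathcomp Require Import all_boot all_fingroup.

Set Implicit Arguments.
Unset Strict Implicit.
Unset Printing Implicit Defensive.

(** Attach the colors to the values instead of the positions: e(v) is the
    color of the letter of value v.  For fixed e, ">_L" induces a linear order
    on the values, [ldes] counts the descents of the word pi for this order and
    [lexc] the excedances v < pi(v).  It remains to send descents to excedances
    for one linear order, which Foata's fundamental transformation does: cut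
    the word before each left-to-right maximum and turn every block into a
    cycle sending each letter to the preceding one.  In terms of products of
    permutations, the image of w_1 ... w_n is the product of the transpositions
    (w_j M_j), where M_j = max(w_1, ..., w_j).  This permutation sends M_n to
    w_n, so the word can be read off from it, starting from the last letter. *)

Section Foata.

Variables (T : finType) (gt : rel T).
Hypothesis gt_slo : strict_linear_order gt.

Lemma slo_irr : irreflexive gt. Proof. by case: gt_slo. Qed.
Lemma slo_trans : transitive gt. Proof. by case: gt_slo. Qed.
Lemma slo_total x y : x != y -> gt x y || gt y x.
Proof. by case: gt_slo => _ _; apply. Qed.

Lemma slo_asym x y : gt x y -> gt y x = false.
Proof.
by move=> xy; apply: contraFF (slo_irr x) => yx; apply: slo_trans xy yx.
Qed.

Fixpoint top (x : T) (s : seq T) : T :=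
  if s is y :: s' then (if gt x (top y s') then x else top y s') else x.

Lemma top_in x s : top x s \in x :: s.
Proof.
elim: s x => [|y s IHs] x /=; first by rewrite inE.
by case: ifP => _; rewrite inE ?eqxx // IHs orbT.
Qed.

Lemma top_max x s z : z \in x :: s -> z != top x s -> gt (top x s) z.
Proof.
elim: s x z => [|y s IHs] x z /=; first by rewrite inE => /eqP-> /eqP.
rewrite inE; case: ifP => [gtx|ngtx] /predU1P[->|zs] //; first by rewrite eqxx.
- move=> _; have [->//|zt] := eqVneq z (top y s).
  exact: slo_trans gtx (IHs _ _ zs zt).
- by move/slo_total; rewrite ngtx.
- exact: IHs.
Qed.

Lemma top_congr x s y t : x :: s =i y :: t -> top x s = top y t.
Proof.
move=> eq_st; apply/eqP/negPn/negP => neq.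
have gt1 : gt (top y t) (top x s) by apply: top_max; rewrite // -eq_st top_in.
have : gt (top x s) (top y t).
  by apply: top_max; rewrite 1?eq_sym // eq_st top_in.
by rewrite (slo_asym gt1).
Qed.

(* Here and in [rdes], words are read from right to left: the head of the list
   is the last letter. *)
Fixpoint foata (s : seq T) : {perm T} :=
  if s is x :: s' then (tperm x (top x s') * foata s')%g else 1%g.

(** With an empty tail, [head] returns its default [x], and [gt x x] adds nothing for an irreflexive
    [gt]. *)
Fixpoint rdes (s : seq T) : nat :=
  if s is x :: s' then gt (head x s') x + rdes s' else 0.

Definition exc (u : {perm T}) : nat := \sum_(z : T) gt (u z) z.

Lemma foata_out s z : z \notin s -> foata s z = z.
Proof.
elim: s z => [|x s IHs] z /=; first by rewrite perm1.
move=> zs; rewrite permM tpermD.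
- by apply: IHs; apply: contra zs; rewrite inE orbC => ->.
- by apply: contraNneq zs => <-; rewrite mem_head.
- by apply: contraNneq zs => <-; rewrite top_in.
Qed.

Lemma foata_top x s : x \notin s -> foata (x :: s) (top x s) = x.
Proof. by move=> xs; rewrite /= permM tpermR foata_out. Qed.

(** Append a last letter [x] after [y]. If [x] is a new maximum, it becomes a fixed point and
    creates no descent. Otherwise, with [m] the old maximum, the arc m -> y becomes m -> x -> y. An
    arc leaving [m] is not an excedance before or after, so only x -> y matters, and it counts
    exactly when [y] followed by [x] is a descent. *)
Lemma exc_foata s : uniq s -> exc (foata s) = rdes s.
Proof.
elim: s => [_|x s IHs /=].
  by rewrite /exc big1 // => z _; rewrite perm1 slo_irr.
case/andP=> xs us; rewrite -{}IHs //.
case: s xs us => [|y s] xs us /=.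
  by rewrite tperm1 mul1g slo_irr.
case: ifP => [gtx|ngtx].
  rewrite tperm1 mul1g; suff -> : gt y x = false by [].
  apply: slo_asym; have [->//|yt] := eqVneq y (top y s).
  by apply: slo_trans gtx _; apply: top_max; rewrite ?mem_head.
rewrite -[(tperm y _ * _)%g]/(foata (y :: s)).
set m := top y s in ngtx *.
have mx : m != x by apply: contraNneq xs => <-; apply: top_in.
have um : foata (y :: s) m = y by apply: foata_top; case/andP: us.
have ux : foata (y :: s) x = x by apply: foata_out.
have gtmx : gt m x by move: (slo_total mx); rewrite ngtx orbF.
have ngtym : gt y m = false.
  have [->|ym] := eqVneq y m; first exact: slo_irr.
  by apply: slo_asym; apply: top_max; rewrite ?mem_head.
move: (foata (y :: s)) um ux => u um ux.
rewrite /exc (bigD1 x) //= (bigD1 m) //= [in RHS](bigD1 x) //=.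
rewrite [in RHS](bigD1 m) //= !permM tpermL tpermR um ux slo_irr ngtym.
rewrite (slo_asym gtmx) !add0n; congr (_ + _); apply: eq_bigr => z.
by case/andP=> zx zm; rewrite permM tpermD // eq_sym.
Qed.

(** Equal letter sets have the same maximum, whose image is the head of either word; so the heads
    agree, the common transposition cancels, and induction applies to the tails. *)
Lemma foata_inj s t :
  uniq s -> uniq t -> s =i t -> foata s = foata t -> s = t.
Proof.
elim: s t => [|x s IHs] [|y t] //.
- by move=> _ _ /(_ y); rewrite mem_head.
- by move=> _ _ /(_ x); rewrite mem_head.
move=> /andP[xs us] /andP[yt ut] eq_st eqF.
have eq_top := top_congr eq_st.
have eqxy : x = y by rewrite -(foata_top xs) -(foata_top yt) eqF eq_top.
move: eqF => /=; rewrite eq_top {1}eqxy => /mulgI eqF.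
congr (_ :: _) => //; apply: IHs => // z.
have := eq_st z; rewrite !inE -eqxy; case: eqVneq => //= -> _.
by rewrite (negPf xs) eqxy (negPf yt).
Qed.

Lemma rdes_rev_mkseq (f : nat -> T) n :
  rdes (rev (mkseq f n.+1)) = \sum_(i < n) gt (f i) (f i.+1).
Proof.
elim: n => [|n IHn]; first by rewrite big_ord0 /= slo_irr.
rewrite mkseqS rev_rcons big_ord_recr /= IHn addnC.
by rewrite mkseqS rev_rcons.
Qed.

End Foata.

Section ColoredPermutations.

Variables (n d : nat) (gtL : rel ('I_n * 'I_d)).
Hypothesis hL : strict_linear_order gtL.

Definition value_color (p : cperm n d) : {ffun 'I_n -> 'I_d} :=
  [ffun v => p.2 (p.1^-1%g v)].

Definition value_gt (e : {ffun 'I_n -> 'I_d}) : rel 'I_n :=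
  fun u v => gtL (u, e u) (v, e v).

Lemma value_gt_slo e : strict_linear_order (value_gt e).
Proof.
case: hL => irr tr tot; split=> [u|v u w|u v uv]; first exact: irr.
  exact: tr.
by apply: tot; apply: contraNneq uv => -[->].
Qed.

Definition with_value_color (u : 'S_n) (e : {ffun 'I_n -> 'I_d}) : cperm n d :=
  (u, [ffun i => e (u i)]).

Lemma with_value_colorK u e : value_color (with_value_color u e) = e.
Proof. by apply/ffunP=> v; rewrite !ffunE /= permKV. Qed.

Lemma value_colorK p : with_value_color p.1 (value_color p) = p.
Proof.
case: p => u c; congr (_, _).
by apply/ffunP=> i; rewrite !ffunE /= permK.
Qed.

(** Position [i] compares the values [u (u i)] and [u i]; the substitution z = u i gives the
    excedance condition at [z]. *)
Lemma lexc_with_value_color u e :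
  lexc gtL (with_value_color u e) = exc (value_gt e) u.
Proof.
rewrite /lexc /exc (reindex_inj (@perm_inj _ u)) /= -sum1dep_card big_mkcond.
by apply: eq_bigr => i _; rewrite /letter /value_gt /= !ffunE; case: gtL.
Qed.

Definition rword (u : 'S_n) : seq 'I_n := rev (codom u).

Lemma rword_uniq u : uniq (rword u).
Proof. by rewrite rev_uniq; apply/injectiveP/perm_inj. Qed.

Lemma mem_rword u v : v \in rword u.
Proof. by rewrite mem_rev -[v](permKV u) codom_f. Qed.

Lemma rword_inj : injective rword.
Proof.
move=> u v /(can_inj revK) eq_uv; apply/permP=> i.
have := congr1 (fun s => nth i s (enum_rank i)) eq_uv.
by rewrite !nth_codom enum_rankK.
Qed.

Definition Phi (p : cperm n d) : cperm n d :=
  let e := value_color p in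
  with_value_color (foata (value_gt e) (rword p.1)) e.

(** [Phi] preserves the value colors, so two words with the same image are transformed for the same
    order. *)
Lemma Phi_inj : injective Phi.
Proof.
move=> p q eqPhi; have eqe : value_color p = value_color q.
  by have := congr1 value_color eqPhi; rewrite !with_value_colorK.
move: (congr1 fst eqPhi); rewrite /= eqe => /(foata_inj (value_gt_slo _)) eqw.
rewrite -(value_colorK p) -(value_colorK q) eqe; congr with_value_color.
apply: rword_inj; apply: eqw; rewrite ?rword_uniq // => v.
by rewrite !mem_rword.
Qed.

End ColoredPermutations.

Lemma ldes_rdes n d (gtL : rel ('I_n * 'I_d)) (hL : strict_linear_order gtL) p :
  ldes gtL p = rdes (value_gt gtL (value_color p)) (rword p.1).
Proof.
case: n gtL hL p => [|n] gtL hL p.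
  rewrite /ldes /rword (size0nil (s := codom _)) ?size_codom ?card_ord //.
  by apply: eq_card0 => -[].
(* [inord] needs a nonempty ordinal type, hence the separate case n = 0 above. *)
pose f k := p.1 (inord k).
have -> : rword p.1 = rev (mkseq f n.+1).
  congr rev; rewrite /mkseq -val_enum_ord -map_comp codomE.
  by apply: eq_map => i /=; rewrite /f inord_val.
rewrite rdes_rev_mkseq; last exact: value_gt_slo.
rewrite /ldes -sum1dep_card big_mkcond big_ord_recr /=.
(* The last position has no successor, so its term vanishes. *)
rewrite [X in _ + X = _](_ : _ = 0) ?addn0; last first.
  case: existsP => // -[j /andP[/eqP jn _]].
  by have := ltn_ord j; rewrite jn ltnn.
apply: eq_bigr => i _; rewrite /value_gt !ffunE !permK.
have iE : inord i = widen_ord (leqnSn n) i.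
  by apply: ord_inj; rewrite inordK // ltnW // ltnS.
have jE : (inord i.+1 : 'I_n.+1) = i.+1 :> nat by rewrite inordK // ltnS.
rewrite /f iE; set b := gtL _ _; suff -> : [exists j : 'I_n.+1,
  (j == i.+1 :> nat) && gtL (letter p (widen_ord (leqnSn n) i)) (letter p j)] = b.
  by case: b.
apply/existsP/idP => [[j /andP[/eqP ji]]|gtb].
  by rewrite /b -ji inord_val.
by exists (inord i.+1); rewrite jE eqxx.
Qed.

Theorem theorem3 (n d : nat) (hn : 0 < n) (hd : 0 < d)
    (gtL : rel ('I_n * 'I_d)) (hL : strict_linear_order gtL) :
  exists Phi : cperm n d -> cperm n d,
    bijective Phi /\ forall p : cperm n d, ldes gtL p = lexc gtL (Phi p).
Proof.
exists (Phi gtL); split; first exact: injF_bij (Phi_inj hL).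
move=> p; rewrite ldes_rdes // lexc_with_value_color exc_foata //.
  exact: value_gt_slo.
exact: rword_uniq.
Qed.
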